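(* Assume $\aleph_1<2^{\aleph_0}$. Let $R$ be a valuation domain of cardinality $\aleph_1$ and $J/A$ a type with $J=\bigcup_{\nu<\omega_1} r_\nu^{-1}R$ as in the context, which is essentially uncountable. Then there is a non-standard uniserial $R$-module of type $J/A$.
   Context: $R$ is a valuation domain with quotient field $Q\neq R$. Uniserial: submodules totally ordered. For $R$-submodules $A\subseteq J$ of $Q$, $J/A$ is uniserial; a uniserial module is standard if isomorphic to such a $J/A$, non-standard otherwise. For uniserial $U$ and $0\ne a\in U$, $\mathrm{Ann}(a)=\{r:ra=0\}$, $D(a)=\bigcup\{r^{-1}R: r\text{ divides }a\}$; $U$ has type $J/A$ if $J/A\cong D(a)/\mathrm{Ann}(a)$. Here $J=\bigcup_{\nu<\omega_1}r_\nu^{-1}R$, $r_\nu\ne0$, $r_\mu\mid r_\nu$ for $\mu<\nu$. The type $J/A$ is essentially uncountable if for every $\nu<\omega_1$ there is $\mu>\nu$ such that $r_\nu A/r_\mu A$ is uncountable. *)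

(* Defs.v *)
From HB Require Import structures.
From mathcomp Require Import all_boot all_order all_algebra fraction.
Set Implicit Arguments. Unset Strict Implicit. Unset Printing Implicit Defensive.
Import Order.TTheory GRing.Theory Num.Theory.
Local Open Scope ring_scope.

Definition countable_set (T : Type) (P : T -> Prop) : Prop :=
  exists f : T -> nat, forall x y, P x -> P y -> f x = f y -> x = y.

Definition omega1_order (I : Type) (lt : I -> I -> Prop) : Prop :=
  (forall x, ~ lt x x) /\
  (forall x y z, lt x y -> lt y z -> lt x z) /\
  (forall x y, lt x y \/ x = y \/ lt y x) /\
  well_founded lt /\
  ~ countable_set (fun _ : I => True) /\
  (forall x, countable_set (fun y => lt y x)).

Definition card_aleph1 (T : Type) : Prop :=
  exists lt : T -> T -> Prop, omega1_order lt.

Definition not_CH : Prop :=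
  forall (T : Type), card_aleph1 T ->
    ~ exists f : T -> (nat -> bool), forall g, exists t, f t = g.

Definition rdvd (R : idomainType) (a b : R) : Prop := exists c, b = c * a.

(* valuation domain whose quotient field Q differs from R *)
Definition valuation_domain (R : idomainType) : Prop :=
  (forall a b : R, rdvd a b \/ rdvd b a) /\
  (exists r : R, r != 0 /\ r \notin GRing.unit).

Notation Qf R := {fraction R}.
Definition emb (R : idomainType) (r : R) : Qf R := FracField.tofrac r.

Definition Qsubmod (R : idomainType) (P : Qf R -> Prop) : Prop :=
  [/\ P 0, (forall x y, P x -> P y -> P (x + y))
    & forall (r : R) x, P x -> P (emb r * x)].

Definition Qsubset (R : idomainType) (P P' : Qf R -> Prop) : Prop :=
  forall x, P x -> P' x.

Definition invR (R : idomainType) (r : R) : Qf R -> Prop :=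
  fun x => exists s : R, x = emb s / emb r.

Definition scaleQ (R : idomainType) (r : R) (A : Qf R -> Prop) : Qf R -> Prop :=
  fun x => exists y, A y /\ x = emb r * y.

Definition countable_quot (R : idomainType) (P P' : Qf R -> Prop) : Prop :=
  exists f : Qf R -> nat, forall x y, P x -> P y -> f x = f y -> P' (x - y).

Definition submod (R : idomainType) (U : lmodType R) (S : U -> Prop) : Prop :=
  [/\ S 0, (forall x y, S x -> S y -> S (x + y))
    & forall (r : R) x, S x -> S (r *: x)].

Definition uniserial (R : idomainType) (U : lmodType R) : Prop :=
  forall S T : U -> Prop, submod S -> submod T ->
    (forall x, S x -> T x) \/ (forall x, T x -> S x).

Definition quot_map (R : idomainType) (U : lmodType R)
    (J A : Qf R -> Prop) (f : Qf R -> U) : Prop :=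
  [/\ (forall x y, J x -> J y -> f (x + y) = f x + f y),
      (forall (r : R) x, J x -> f (emb r * x) = r *: f x),
      (forall u, exists x, J x /\ f x = u)
    & forall x, J x -> (f x = 0 <-> A x)].

Definition standard (R : idomainType) (U : lmodType R) : Prop :=
  exists (J A : Qf R -> Prop) (f : Qf R -> U),
    [/\ Qsubmod J, Qsubmod A, Qsubset A J & quot_map J A f].

(* J/A ~= D/B, for submodules B <= D, A <= J of Q, witnessed by a lift
   g : J -> D of the isomorphism (g is linear modulo B) *)
Definition quot_iso (R : idomainType) (J A D B : Qf R -> Prop) : Prop :=
  exists g : Qf R -> Qf R,
  [/\ (forall x, J x -> D (g x)),
      (forall x y, J x -> J y -> B (g (x + y) - (g x + g y))),
      (forall (r : R) x, J x -> B (g (emb r * x) - emb r * g x)),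
      (forall d, D d -> exists x, J x /\ B (g x - d))
    & forall x, J x -> (B (g x) <-> A x)].

Definition Ann (R : idomainType) (U : lmodType R) (a : U) : Qf R -> Prop :=
  fun x => exists r : R, x = emb r /\ r *: a = 0.

Definition Dv (R : idomainType) (U : lmodType R) (a : U) : Qf R -> Prop :=
  fun x => exists r : R, (exists b : U, r *: b = a) /\ invR r x.

Definition has_type (R : idomainType) (U : lmodType R)
    (J A : Qf R -> Prop) : Prop :=
  exists a : U, a != 0 /\ quot_iso J A (Dv a) (Ann a).

(* Main.v *)
(** The module is a direct limit, over the levels [i] of [omega1], of the modules
    [r_i^-1 R / A] along multiplication by units [e j i] that compose correctly
    modulo the ideals [r_i A]. It is standard exactly when the twist [e] is
    trivial, i.e. when there are units [c i] with [c i = e j i * c j] modulo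
    [r_i A] for all [i < j]. A non-trivial [e] is built by recursion: filter [R]
    by countable sets [R_d] and, at a level [d] that is the limit of levels
    [s n] with [r_(s n) A / r_(s n+1) A] uncountable, let the extensions of [e]
    to [d] branch at every [s n], the two choices differing by a factor that is
    not a quotient of units of [R_d] modulo [r_(s n+1) A]. Then a given value of
    [c d] is compatible with [c i] in [R_d] for all [i < d] on at most one of
    the [2^aleph0] branches, and [R] has only [aleph1] elements, so some branch
    is compatible with none. Every family [c] takes its values below [d] in
    [R_d] for some such [d]. *)
Require Import Defs.
From HB Require Import structures.
From mathcomp Require Import all_boot all_order all_algebra fraction.
From mathcomp Require Import boolp.
Set Implicit Arguments. Unset Strict Implicit. Unset Printing Implicit Defensive.
Import GRing.Theory.
Local Open Scope ring_scope.

(** * Recursion by choice, and countable sets *)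

(** A next value is only known to exist after values satisfying [P], so a selector [e], defined on
    all predicates, is fixed first; induction then shows that it only met nonempty ones. *)
Lemma wf_rec_choice (X Y : Type) (lt : X -> X -> Prop)
    (P : X -> (X -> Y) -> Y -> Prop) (y0 : Y) :
  well_founded lt ->
  (forall x f g y, (forall z, lt z x -> f z = g z) -> P x f y -> P x g y) ->
  (forall x f, (forall z, lt z x -> P z f (f z)) -> exists y, P x f y) ->
  exists f, forall x, P x f (f x).
Proof.
move=> wf Ploc Pstep.
have /choice [e eP] (Q : Y -> Prop) : exists y, (exists y', Q y') -> Q y.
  by have [[y Qy]|nQ] := EM (exists y, Q y); [exists y | exists y0].
pose ext x (g : forall z, lt z x -> Y) z :=
  if pselect (lt z x) is left h then g z h else y0.
pose F x g := e (P x (ext x g)).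
pose f := Fix wf _ F; exists f => x.
elim/(well_founded_ind wf): x => x IH.
have -> : f x = F x (fun z _ => f z).
  rewrite {1}/f Fix_eq // => z g h gh; congr (F z _).
  by apply: functional_extensionality_dep => t; apply: funext => ?; exact: gh.
have fext z : lt z x -> ext x (fun z _ => f z) z = f z.
  by rewrite /ext; case: pselect.
apply: (Ploc _ _ _ _ fext); apply: eP; have [y Py] := Pstep x f IH.
by exists y; apply: Ploc Py => z /fext.
Qed.

Lemma countable_image (T U : Type) (g : T -> U) (P : T -> Prop) :
  countable_set P -> countable_set (fun u => exists2 x, P x & u = g x).
Proof.
move=> [f fP].
have /choice [p pP] u : exists n, (exists2 x, P x & u = g x) ->
    exists x, [/\ P x, u = g x & n = f x].
  have [[x Px ->]|nP] := EM (exists2 x, P x & u = g x); last by exists 0%N.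
  by exists (f x) => _; exists x.
exists p => u v /pP [x [Px -> ->]] /pP [y [Py -> ->]] /fP.
by move=> /(_ Px Py) ->.
Qed.

Lemma countable_enum (T : Type) (P : T -> Prop) (x0 : T) :
  P x0 -> countable_set P ->
  exists g : nat -> T, (forall n, P (g n)) /\ forall x, P x -> exists n, g n = x.
Proof.
move=> Px0 [f fP].
have /choice [g gP] n : exists x, P x /\ ((exists2 y, P y & f y = n) -> f x = n).
  have [[y Py fy]|nP] := EM (exists2 y, P y & f y = n); first by exists y.
  by exists x0.
exists g; split=> [n|x Px]; first by have [] := gP n.
exists (f x); have [Pg] := gP (f x).
by move=> /(_ (ex_intro2 _ _ x Px erefl)); exact: fP.
Qed.

(** * The order type omega1 *)

Section Omega1.
Variables (I : Type) (lt : I -> I -> Prop).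
Hypothesis ltI : omega1_order lt.

Definition le x y := lt x y \/ x = y.

Lemma lt_irr x : ~ lt x x.
Proof. by case: ltI => h _; exact: h. Qed.

Lemma lt_trans x y z : lt x y -> lt y z -> lt x z.
Proof. by case: ltI => _ [h _]; exact: h. Qed.

Lemma lt_wf : well_founded lt.
Proof. by case: ltI => _ [_ [_ []]]. Qed.

Lemma lt_or_le x y : lt x y \/ le y x.
Proof.
case: ltI => _ [_ [h _]].
by have [?|[->|?]] := h x y; [left | right; right | right; left].
Qed.

Lemma le_refl x : le x x. Proof. by right. Qed.

Lemma le_lt_trans x y z : le x y -> lt y z -> lt x z.
Proof. by case=> [xy /(lt_trans xy)|->]. Qed.

Lemma lt_le_trans x y z : lt x y -> le y z -> lt x z.
Proof. by move=> xy [/(lt_trans xy)|<-]. Qed.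

Lemma le_trans x y z : le x y -> le y z -> le x z.
Proof. by move=> xy [/(le_lt_trans xy)|<-]; [left|]. Qed.

Lemma le_total x y : le x y \/ le y x.
Proof. by have [?|?] := lt_or_le x y; [left; left | right]. Qed.

Lemma ub2 x y : exists z, le x z /\ le y z.
Proof.
by have [?|?] := le_total x y; [exists y | exists x]; split=> //; exact: le_refl.
Qed.

Lemma lt_countable x : countable_set (lt^~ x).
Proof. by case: ltI => _ [_ [_ [_ [_ h]]]]; exact: h. Qed.

Lemma le_countable x : countable_set (le^~ x).
Proof.
have [f fP] := lt_countable x.
pose g y := if pselect (y = x) then 0%N else (f y).+1.
exists g => y z yx zx; rewrite /g.
case: pselect => [yE|ny]; case: pselect => [zE|nz] //.
  by move=> _; rewrite zE.
by case: yx zx => // yx [] // zx [fyz]; apply: fP fyz.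
Qed.

(** If [P] were unbounded, each [b] would lie below some [m b] in [P]; the code of [m b] and that of
    [b] in the countable segment up to [m b] would make [I] countable. *)
Lemma countable_bounded (P : I -> Prop) :
  countable_set P -> exists b, forall x, P x -> lt x b.
Proof.
move=> [f fP]; apply: contrapT => nb.
have /choice [m mP] b : exists x, P x /\ le b x.
  apply: contrapT => nx; apply: nb; exists b => x Px.
  by have [//|bx] := lt_or_le x b; case: nx; exists x.
have /choice [g gP] x : exists g : I -> nat,
    forall y z, le y x -> le z x -> g y = g z -> y = z.
  exact: le_countable.
case: ltI => _ [_ [_ [_ [unc _]]]]; apply: unc.
exists (fun b => pickle (f (m b), g (m b) b)) => b c _ _.
move=> /(pcan_inj pickleK) [] fm.
have [Pb bm] := mP b; have [Pc cm] := mP c.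
by move: cm; rewrite -(fP _ _ Pb Pc fm); exact: gP.
Qed.

Lemma omega1_inhabited : inhabited I.
Proof.
apply: contrapT => nI; case: ltI => _ [_ [_ [_ [unc _]]]]; apply: unc.
by exists (fun=> 0%N) => x; case: nI.
Qed.

Lemma omega1_least (P : I -> Prop) :
  (exists x, P x) -> exists x, P x /\ forall y, P y -> le x y.
Proof.
move=> [x]; elim/(well_founded_ind lt_wf): x => x IH Px.
have [[y [yx Py]]|nP] := EM (exists y, lt y x /\ P y); first exact: IH Py.
exists x; split=> // y Py; have [yx|//] := lt_or_le y x.
by case: nP; exists y.
Qed.

Lemma omega1_sup (s : nat -> I) : (forall n, lt (s n) (s n.+1)) ->
  exists d, (forall n, lt (s n) d) /\
            (forall x, lt x d -> exists n, le x (s n)).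
Proof.
move=> sS.
have [|b bP] := @countable_bounded (fun x => exists2 n, True & x = s n).
  by apply: countable_image; exists id.
have [|d [dP dmin]] := @omega1_least (fun d => forall n, lt (s n) d).
  by exists b => n; apply: bP; exists n.
exists d; split=> // x xd; apply: contrapT => nx.
suff /dmin/(lt_le_trans xd)/lt_irr : forall n, lt (s n) x by [].
by move=> n; have [//|?] := lt_or_le (s n) x; case: nx; exists n.
Qed.

(** Running maxima of an enumeration of the segment below [x], started at [y]. They increase only
    weakly, since [x] may be a successor. *)
Lemma omega1_cofinal x y : lt y x -> exists s : nat -> I,
  [/\ forall n, le (s n) (s n.+1), forall n, lt (s n) x
    & forall z, lt z x -> exists n, le z (s n)].
Proof.
move=> yx; have [g [gx gP]] := countable_enum yx (lt_countable x).
pose mx a b := if pselect (le a b) then b else a.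
have mxl a b : le a (mx a b) by rewrite /mx; case: pselect => [|?] //; right.
have mxr a b : le b (mx a b).
  rewrite /mx; case: pselect => [?|nab]; first by right.
  by have [|//] := le_total a b.
pose s n := iteri n (fun i a => mx a (g i)) y.
exists s; split=> [n|n|z /gP [n <-]]; first exact: mxl; last first.
  by exists n.+1; exact: mxr.
elim: n => [//|n IH]; rewrite /s /= -/(s n) /mx.
by case: pselect => [?|?] /=; [exact: gx | exact: IH].
Qed.

(* The sets [h a < x] filter [T] by countable sets. *)
Lemma card_aleph1_embed (T : Type) : card_aleph1 T ->
  exists h : T -> I, injective h.
Proof.
move=> [ltT [irr [_ [tot [wf [_ cnt]]]]]]; have [i0] := omega1_inhabited.
have [|x f|h hP] := @wf_rec_choice T I ltT
    (fun a f i => forall b, ltT b a -> lt (f b) i) i0 wf.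
- by move=> x f g i fg fi b bx; rewrite -fg //; exact: fi.
- move=> _; have [b bP] := countable_bounded (countable_image f (cnt x)).
  by exists b => y yx; apply: bP; exists y.
exists h => a b hab.
by have [/hP|[//|/hP]] := tot a b; rewrite hab => /lt_irr.
Qed.

End Omega1.

(** * A nontrivial twist for a decreasing chain of ideals [N i] *)

Definition countable_mod (V : zmodType) (P P' : V -> Prop) : Prop :=
  exists f : V -> nat, forall x y, P x -> P y -> f x = f y -> P' (x - y).

Section Twist.
Variables (I : Type) (lt : I -> I -> Prop).
Hypothesis ltI : omega1_order lt.
Variables (R : comUnitRingType) (N : I -> R -> Prop).
Hypothesis N0 : forall i, N i 0.
Hypothesis ND : forall i a b, N i a -> N i b -> N i (a + b).
Hypothesis NM : forall i a b, N i b -> N i (a * b).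
Hypothesis Nsub : forall i j a, le lt i j -> N j a -> N i a.
Hypothesis Nunit : forall i a, N i a -> 1 + a \is a GRing.unit.
Hypothesis Nunc : forall i, exists j, lt i j /\ ~ countable_mod (N i) (N j).
Variable h : R -> I.
Hypothesis h_inj : injective h.

Definition cong i (a b : R) := N i (a - b).

Lemma cong_refl i a : cong i a a.
Proof. by rewrite /cong subrr. Qed.

Lemma cong_sym i a b : cong i a b -> cong i b a.
Proof. by move=> /(NM (-1)); rewrite mulN1r opprB. Qed.

Lemma cong_trans i b a c : cong i a b -> cong i b c -> cong i a c.
Proof. by move=> /ND ab /ab; rewrite /cong addrA subrK. Qed.

Lemma cong_mull i c a b : cong i a b -> cong i (c * a) (c * b).
Proof. by move=> /(NM c); rewrite mulrBr. Qed.

Lemma cong_sub i j a b : le lt i j -> cong j a b -> cong i a b.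
Proof. exact: Nsub. Qed.

(* [e m n] is the unit by which one passes from level [n] to the higher level
   [m]; [y n] is a candidate for [e d n]. *)
Definition coherent d (e : I -> I -> R) (y : I -> R) :=
  [/\ y d = 1, forall n, lt n d -> y n \is a GRing.unit
    & forall n m, lt n m -> lt m d -> cong n (y n) (e m n * y m)].

Definition ladder d (s : nat -> I) :=
  [/\ forall n, lt (s n) (s n.+1), forall n, lt (s n) d,
      forall x, lt x d -> exists n, le lt x (s n)
    & forall n, ~ countable_mod (N (s n)) (N (s n.+1))].

(* [h a < d] bounds [a] to a countable set: no sequence of units from that set
   extends to level [d]. *)
Definition unreachable d (y : I -> R) :=
  forall c, c \is a GRing.unit -> exists2 n, lt n d &
    forall a, a \is a GRing.unit -> lt (h a) d -> ~ cong n (y n * c) a.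

(** Unreachability is asked only where a ladder offers uncountable quotients to branch in. *)
Definition good d e y :=
  coherent d e y /\ ((exists s, ladder d s) -> unreachable d y).

Lemma ladder_le s : (forall n, le lt (s n) (s n.+1)) ->
  forall n m, (n <= m)%N -> le lt (s n) (s m).
Proof.
move=> sS n m; elim: m => [|m IH]; first by rewrite leqn0 => /eqP ->; right.
rewrite leq_eqVlt => /orP [/eqP ->|/IH nm]; first by right.
exact: le_trans ltI _ _ _ nm (sS m).
Qed.

(** Put [y i := e (s n) i * x n] for any [n] with [i] at most [s n]; compatibility of the [x n]
    makes the choice of [n] irrelevant modulo [N i]. *)
Lemma coherent_extend d e s x :
  (forall m, lt m d -> coherent m e (e m)) ->
  (forall n, le lt (s n) (s n.+1)) -> (forall n, lt (s n) d) ->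
  (forall i, lt i d -> exists n, le lt i (s n)) ->
  (forall n, x n \is a GRing.unit) ->
  (forall n, cong (s n) (x n) (e (s n.+1) (s n) * x n.+1)) ->
  exists y, coherent d e y /\ forall n, cong (s n) (y (s n)) (x n).
Proof.
move=> eC sS sd scof xU xS.
have e1 m : lt m d -> e m m = 1 by case/eC.
have eU m i : lt m d -> le lt i m -> e m i \is a GRing.unit.
  by move=> /eC [em eu _] [/eu //|->]; rewrite em unitr1.
have eE i j m : le lt i j -> le lt j m -> lt m d ->
    cong i (e m i) (e j i * e m j).
  move=> ij [jm|->] md; last by rewrite e1 // mulr1; exact: cong_refl.
  case: ij => [ij|->]; first by case: (eC _ md) => _ _; apply.
  by rewrite e1 ?mul1r; [exact: cong_refl | exact: (lt_trans ltI jm md)].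
have eS n m i : (n <= m)%N -> le lt i (s n) ->
    cong i (e (s n) i * x n) (e (s m) i * x m).
  move=> nm isn; elim: m nm => [|m IH].
    by rewrite leqn0 => /eqP ->; exact: cong_refl.
  rewrite leq_eqVlt => /orP [/eqP ->|]; first exact: cong_refl.
  rewrite ltnS => nm; apply: cong_trans (IH nm) _.
  have ism := le_trans ltI isn (ladder_le sS nm).
  apply: cong_trans (cong_mull _ (cong_sub ism (xS m))) _.
  rewrite mulrA mulrC [X in cong _ _ X]mulrC; apply: cong_mull.
  exact: cong_sym (eE _ _ _ ism (sS m) (sd _)).
have /choice [k kP] i : exists n, lt i d -> le lt i (s n).
  by have [/scof [n ?]|?] := EM (lt i d); [exists n | exists 0%N].
pose y i := if pselect (i = d) then 1 else e (s (k i)) i * x (k i).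
have yE i : lt i d -> y i = e (s (k i)) i * x (k i).
  have [->|] := EM (i = d); first by move=> /(lt_irr ltI).
  by rewrite /y; case: pselect.
have yP i m : lt i d -> le lt i (s m) -> cong i (y i) (e (s m) i * x m).
  move=> id ism; rewrite yE //; have ik := kP _ id.
  by have [km|/ltnW mk] := leqP (k i) m; [| apply: cong_sym]; exact: eS.
exists y; split; last first.
  move=> n; apply: cong_trans (yP _ n (sd n) (le_refl _ _)) _.
  by rewrite e1 // mul1r; exact: cong_refl.
split=> [|n nd|n m nm md].
- by rewrite /y; case: pselect.
- by rewrite yE // unitrM xU eU //; exact: kP.
- have [p mp] := scof _ md; have nd := lt_trans ltI nm md.
  have np := le_trans ltI (or_introl nm) mp.
  apply: cong_trans (yP _ p nd np) _.
  apply: (@cong_trans n (e m n * (e (s p) m * x p))).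
    rewrite mulrA mulrC [X in cong _ _ X]mulrC; apply: cong_mull.
    by apply: eE => //; left.
  by apply: cong_mull; apply: cong_sym; apply: cong_sub (yP _ _ md mp); left.
Qed.

(** Otherwise each [v] in [N i] has [a], [b] in the countable set with [(1 + v) * a] congruent to
    [b]. As [a] is a unit, the pair determines [v] modulo [N j], so the quotient would be
    countable. *)
Lemma kernel_escape d i j :
  ~ countable_mod (N i) (N j) -> exists2 v, N i v &
    forall a b, a \is a GRing.unit -> lt (h a) d -> b \is a GRing.unit ->
      lt (h b) d -> ~ cong j ((1 + v) * a) b.
Proof.
move=> unc; apply: contrapT => esc; apply: unc.
have [f fP] := lt_countable ltI d.
have /choice [g gP] v : exists n, N i v -> exists ab : R * R,
    [/\ ab.1 \is a GRing.unit /\ lt (h ab.1) d,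
        ab.2 \is a GRing.unit /\ lt (h ab.2) d, cong j ((1 + v) * ab.1) ab.2
      & n = pickle (f (h ab.1), f (h ab.2))].
  have [Nv|?] := EM (N i v); last by exists 0%N.
  suff [a [b [? ? ?]]] : exists a b,
      [/\ a \is a GRing.unit /\ lt (h a) d,
        b \is a GRing.unit /\ lt (h b) d & cong j ((1 + v) * a) b].
    by exists (pickle (f (h a), f (h b))) => _; exists (a, b).
  apply: contrapT => nab; apply: esc; exists v => // a b aU ad bU bd vab.
  by apply: nab; exists a, b.
exists g => v w /gP [[a b] /= [[aU ad] [_ bd] vab ->]].
move=> /gP [[a' b'] /= [[_ a'd] [_ b'd] wab ->]].
move=> /(pcan_inj pickleK) [] /(fP _ _ ad a'd)/h_inj aE /(fP _ _ bd b'd)/h_inj bE.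
rewrite -{}aE -{}bE in wab.
have := cong_mull a^-1 (cong_trans vab (cong_sym wab)); rewrite /cong.
by rewrite -mulrBr -mulrBl mulrCA mulVr // mulr1 opprD addrACA subrr add0r.
Qed.

(* The branches [b : nat -> bool] of a binary tree of candidate extensions are
   pairwise separated modulo the countable set [h a < d], so each [c] obstructs
   at most one of them. *)
Lemma good_ladder d e s :
  (forall F : R -> nat -> bool, exists b, forall c, F c <> b) ->
  (forall m, lt m d -> coherent m e (e m)) -> ladder d s ->
  exists y, coherent d e y /\ unreachable d y.
Proof.
move=> diag eC [sS sd scof sunc].
have /choice [v vP] n : exists v, N (s n) v /\
    forall a b, a \is a GRing.unit -> lt (h a) d -> b \is a GRing.unit ->
      lt (h b) d -> ~ cong (s n.+1) ((1 + v) * a) b.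
  by have [v] := kernel_escape d (sunc n); exists v.
have vN n : N (s n) (v n) by case: (vP n).
(* [u b n] is congruent to 1 modulo [N (s n)], so either value of [b n] respects compatibility at
   [s n]; the two are told apart modulo [N (s n.+1)]. *)
pose u (b : nat -> bool) n := if b n then 1 + v n else 1.
pose x b n := iteri n (fun i a => a * (e (s i.+1) (s i))^-1 * u b i) 1.
have eU n : e (s n.+1) (s n) \is a GRing.unit.
  by case: (eC _ (sd n.+1)) => _ + _; apply.
have uU b n : u b n \is a GRing.unit.
  by rewrite /u; case: ifP => _; [exact: Nunit (vN n) | exact: unitr1].
have xU b n : x b n \is a GRing.unit.
  elim: n => [|n IH]; first exact: unitr1.
  by rewrite /x /= -/(x b n) !unitrM IH unitrV eU uU.
have xS b n : cong (s n) (x b n) (e (s n.+1) (s n) * x b n.+1).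
  rewrite {2}/x /= -/(x b n) mulrA mulrCA mulrA mulrK //.
  rewrite -{1}[x b n]mulr1; apply: cong_mull; rewrite /u /cong.
  case: ifP => _; last by rewrite subrr.
  by rewrite opprD addNKr -mulN1r; exact: NM.
pose bad b c := c \is a GRing.unit /\ forall n, exists a,
  [/\ a \is a GRing.unit, lt (h a) d & cong (s n) (x b n * c) a].
have bad_inj b b' c : bad b c -> bad b' c -> b = b'.
  move=> [cU bc] [_ b'c]; apply: funext => k; apply: contrapT => /eqP bk.
  (* At the first difference [n] the products up to [n] agree, so modulo [N (s n.+1)] the next ones
     differ by the factor [1 + v n], against the choice of [v n]. *)
  have [n bn nmin] := ex_minnP (ex_intro (fun n => b n != b' n) k bk).
  have xE : x b n = x b' n.
    suff: forall m, (m <= n)%N -> x b m = x b' m by apply.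
    elim=> // m IH mn; rewrite /x /= -/(x b m) -/(x b' m) IH 1?ltnW // /u.
    case: (eqVneq (b m) (b' m)) => [-> //|/nmin].
    by rewrite leqNgt mn.
  have [_ vesc] := vP n.
  have [a [aU ad ba]] := bc n.+1; have [a' [a'U a'd b'a']] := b'c n.+1.
  move: ba b'a'; rewrite /x /= -/(x b n) -/(x b' n) -xE /u.
  set X := x b n * _.
  have key a1 a2 : a1 \is a GRing.unit -> lt (h a1) d -> a2 \is a GRing.unit ->
      lt (h a2) d -> cong (s n.+1) (X * (1 + v n) * c) a1 ->
      cong (s n.+1) (X * 1 * c) a2 -> False.
    move=> a1U a1d a2U a2d Xa1; rewrite mulr1 => Xa2.
    apply: (vesc a2 a1) => //; apply: cong_trans Xa1.
    by rewrite [X * _]mulrC -mulrA; apply: cong_mull; exact: cong_sym.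
  by case: (b n) (b' n) bn => [] [] // _ ba b'a'; [exact: key ba b'a' | exact: key b'a' ba].
(* [F c] is the only branch that [c] can obstruct; [diag] yields a branch outside the range of
   [F]. *)
have /choice [F FP] c : exists b, forall b', bad b' c -> b = b'.
  have [[b bc]|nb] := EM (exists b, bad b c).
    by exists b => b'; exact: bad_inj.
  by exists xpredT => b bc; case: nb; exists b.
have [b bF] := diag F.
have [y [yC yx]] := coherent_extend eC (fun n => or_introl (sS n)) sd scof
  (xU b) (xS b).
exists y; split=> // c cU; apply: contrapT => nc.
apply: (bF c); apply: FP; split=> // n; apply: contrapT => na.
apply: nc; exists (s n) => // a aU ad yca; apply: na; exists a; split=> //.
by apply: cong_trans yca; rewrite !(mulrC _ c); apply: cong_mull; exact: cong_sym.
Qed.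

Lemma good_step d e :
  (forall F : R -> nat -> bool, exists b, forall c, F c <> b) ->
  (forall m, lt m d -> coherent m e (e m)) -> exists y, good d e y.
Proof.
move=> diag eC; have [[s sd]|nlad] := EM (exists s, ladder d s).
  by have [y [yC yu]] := good_ladder diag eC sd; exists y.
have [[i id]|nd] := EM (exists i, lt i d); last first.
  exists (fun=> 1); split=> //; split=> // n; first by move=> nd'; case: nd; exists n.
  by move=> m nm md; case: nd; exists m.
(* Without a ladder nothing branches: starting from 1, the values along a cofinal sequence are
   obtained by dividing by the [e]. *)
have [s [sS sd scof]] := omega1_cofinal ltI id.
pose x n := iteri n (fun i a => a * (e (s i.+1) (s i))^-1) 1.
have eU n : e (s n.+1) (s n) \is a GRing.unit.
  have [e1 eu _] := eC _ (sd n.+1).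
  by case: (sS n) => [/eu //|->]; rewrite e1 unitr1.
have xU n : x n \is a GRing.unit.
  elim: n => [|n IH]; first exact: unitr1.
  by rewrite /x /= -/(x n) unitrM IH unitrV eU.
have [|y [yC _]] := @coherent_extend d e s x eC sS sd scof xU; last first.
  by exists y; split.
by move=> n; rewrite {2}/x /= -/(x n) mulrCA mulrV // mulr1; exact: cong_refl.
Qed.

(** Iterate [f], which climbs past an uncountable quotient and past [h (c k)] for all earlier [k],
    and take the supremum. *)
Lemma ladder_closed (c : I -> R) :
  exists d s, ladder d s /\ forall i, lt i d -> lt (h (c i)) d.
Proof.
have /choice [f fP] i : exists j, [/\ lt i j, ~ countable_mod (N i) (N j)
    & forall k, le lt k i -> lt (h (c k)) j].
  have [j [ij unc]] := Nunc i.
  have [b bP] := countable_bounded ltI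
    (countable_image (fun k => h (c k)) (le_countable ltI i)).
  have [m [jm bm]] := ub2 ltI j b; exists m; split.
  - exact: lt_le_trans ltI _ _ _ ij jm.
  (* Raising [j] to [m] shrinks the ideal divided out, so the quotient stays uncountable. *)
  - move=> [g gP]; apply: unc; exists g => x y Nx Ny gxy.
    by apply: Nsub jm _; exact: gP.
  - by move=> k ki; apply: lt_le_trans ltI _ _ _ _ bm; apply: bP; exists k.
have [i0] := omega1_inhabited ltI.
pose s n := iter n f i0.
have sS n : lt (s n) (s n.+1) by case: (fP (s n)).
have [d [sd dcof]] := omega1_sup ltI sS.
exists d, s; split=> [|i /dcof [n isn]].
  by split=> // n; case: (fP (s n)).
by apply: (lt_trans ltI) (sd n.+1); case: (fP (s n)) => _ _; apply.
Qed.

Theorem nontrivial_twist :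
  (forall F : R -> nat -> bool, exists b, forall c, F c <> b) ->
  exists e : I -> I -> R,
    [/\ forall i, e i i = 1,
        forall i j, le lt i j -> e j i \is a GRing.unit,
        forall i j k, le lt i j -> le lt j k -> cong i (e k i) (e j i * e k j)
      & forall c, (forall i, c i \is a GRing.unit) ->
          ~ forall i j, lt i j -> cong i (e j i * c j) (c i)].
Proof.
move=> diag.
(* The recursion chooses a whole row [e d] at each level [d]. *)
have [|d e eC|e eP] := @wf_rec_choice I (I -> R) lt good (fun=> 1) (lt_wf ltI).
- move=> d e e' y ee' [[y1 yU yC] yu]; split=> //; split=> // n m nm md.
  by rewrite -ee' //; exact: yC.
- by apply: good_step => // m /eC [].
have e1 i : e i i = 1 by case: (eP i) => [[]].
exists e; split=> // [i j|i j k ij [jk|->]|c cU cE].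
- by move=> [ij|->]; [case: (eP j) => [[_ + _] _]; apply | rewrite e1 unitr1].
- case: ij => [ij|->]; last by rewrite e1 mul1r; exact: cong_refl.
  by case: (eP k) => [[_ _ +] _]; apply.
- by rewrite e1 mulr1; exact: cong_refl.
have [d [s [lads cd]]] := ladder_closed c.
have [_ /(_ (ex_intro _ s lads)) un] := eP d.
have [n nd] := un _ (cU d).
by move=> /(_ _ (cU n) (cd _ nd)); apply; exact: cE.
Qed.

End Twist.

(** * Subquotients of modules *)

(** [rep] picks one canonical element in each coset of [N]; its fixed points in [S] form the
    carrier, with the operations of [V] followed by [rep]. *)
Lemma subquotient_lmod (R : idomainType) (V : lmodType R) (S N : V -> Prop) :
  submod S -> submod N -> (forall x, N x -> S x) ->
  exists (U : lmodType R) (p : V -> U),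
    [/\ forall x y, S x -> S y -> p (x + y) = p x + p y,
        forall (r : R) x, S x -> p (r *: x) = r *: p x,
        forall u, exists x, S x /\ p x = u
      & forall x, S x -> (p x = 0 <-> N x)].
Proof.
move=> [S0 SD SZ] [N0 ND NZ] NS.
have NN x : N x -> N (- x) by move=> /(NZ (-1)); rewrite scaleN1r.
have SN x : S x -> S (- x) by move=> /(SZ (-1)); rewrite scaleN1r.
pose rep v := choose (fun w => `[<N (v - w)>]) v.
have repN v : N (v - rep v).
  by apply/asboolP/(@chooseP _ (fun w => `[<N (v - w)>])); rewrite subrr; exact/asboolP.
have repE v w : N (v - w) -> rep v = rep w.
  move=> vw; have wv := NN _ vw; rewrite /rep.
  rewrite (@eq_choose _ _ (fun t => `[<N (w - t)>])); last first.
    move=> t; apply: asbool_equiv_eq; split=> [vt|wt].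
      have -> : w - t = - (v - w) + (v - t) by rewrite opprB addrA subrK.
      exact: ND.
    have -> : v - t = (v - w) + (w - t) by rewrite addrA subrK.
    exact: ND.
  apply: choose_id; first by apply/asboolP; rewrite -opprB.
  by rewrite subrr; exact/asboolP.
have repS v : S v -> S (rep v).
  move=> Sv; have -> : rep v = v - (v - rep v) by rewrite opprB addrCA subrr addr0.
  by apply: SD => //; apply: SN; apply: NS.
have repK v : rep (rep v) = rep v.
  by apply: repE; rewrite -opprB; exact: NN.
have repD v w : rep (rep v + w) = rep (v + w).
  apply: repE; rewrite opprD addrACA subrr addr0 -opprB; exact: NN.
have repDr v w : rep (v + rep w) = rep (v + w) by rewrite addrC repD addrC.
have repZ r v : rep (r *: rep v) = rep (r *: v).
  by apply: repE; rewrite -scalerBr; apply: (NZ r); rewrite -opprB; exact: NN.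
pose P v := `[<S v /\ rep v = v>].
pose T : choiceType := {v : V | P v}.
have mkP v : S v -> P (rep v).
  by move=> Sv; apply/asboolP; split; [exact: repS | exact: repK].
pose mk v (Sv : S v) : T := exist _ (rep v) (mkP v Sv).
have TS (t : T) : S (val t) by case: t => v /= /asboolP [].
have Tr (t : T) : rep (val t) = val t by case: t => v /= /asboolP [].
pose addT (x y : T) := mk _ (SD _ _ (TS x) (TS y)).
pose oppT (x : T) := mk _ (SN _ (TS x)).
pose zeroT := mk _ S0.
pose scaleT (r : R) (x : T) := mk _ (SZ r _ (TS x)).
have addC : commutative addT.
  by move=> x y; apply: val_inj; rewrite /= addrC.
have addA : associative addT.
  by move=> x y z; apply: val_inj; rewrite /= repD repDr addrA.
have add0 : left_id zeroT addT.
  by move=> x; apply: val_inj; rewrite /= repD add0r Tr.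
have addN : left_inverse zeroT oppT addT.
  by move=> x; apply: val_inj; rewrite /= repD addNr.
pose Z : zmodType := HB.pack (Choice.sort T) (GRing.isZmodule.Build T addA addC add0 addN).
have scA (a b : R) (v : Z) : scaleT a (scaleT b v) = scaleT (a * b) v.
  by apply: val_inj; rewrite /= repZ scalerA.
have sc1 : left_id 1 (scaleT : R -> Z -> Z).
  by move=> v; apply: val_inj; rewrite /= scale1r Tr.
have scDr : right_distributive (scaleT : R -> Z -> Z) +%R.
  move=> a x y; apply: val_inj; rewrite /= repZ scalerDr.
  by rewrite repD repDr.
have scDl (v : Z) : {morph (scaleT^~ v : R -> Z) : a b / a + b}.
  move=> a b; apply: val_inj; rewrite /= scalerDl.
  by rewrite repD repDr.
pose U : lmodType R := HB.pack (GRing.Zmodule.sort Z)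
  (GRing.Zmodule_isLmodule.Build R Z scA sc1 scDr scDl).
pose p v : U := if pselect (S v) is left Sv then mk v Sv else zeroT.
have pE v : S v -> val (p v : T) = rep v.
  by rewrite /p; case: pselect.
exists U, p; split=> [x y Sx Sy|r x Sx|u|x Sx].
- apply: (@val_inj _ _ T); rewrite pE; last by apply: (SD x y).
  by rewrite /= pE // pE // repD repDr.
- apply: (@val_inj _ _ T); rewrite pE; last by apply: (SZ r).
  by rewrite /= pE // repZ.
- exists (val (u : T)); split; first exact: TS.
  by apply: (@val_inj _ _ T); rewrite pE // Tr.
- split=> [px|Nx].
    have := repN x; rewrite -(pE x Sx) px /=.
    have : N (rep 0) by have := NN _ (repN 0); rewrite sub0r opprK.
    by move=> r0 xr; rewrite -[x](subrK (rep 0)); exact: ND.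
  by apply: (@val_inj _ _ T); rewrite pE //=; apply: repE; rewrite subr0.
Qed.

(** * The ambient module of families in the quotient field *)

Definition Qfun (R : idomainType) (I : Type) := I -> Qf R.

Section QfunLmod.
Variables (R : idomainType) (I : Type).

HB.instance Definition _ := gen_eqMixin (Qfun R I).
HB.instance Definition _ := gen_choiceMixin (Qfun R I).

Definition qfun_zero : Qfun R I := fun=> 0.
Definition qfun_add (f g : Qfun R I) : Qfun R I := fun i => f i + g i.
Definition qfun_opp (f : Qfun R I) : Qfun R I := fun i => - f i.
Definition qfun_scale (r : R) (f : Qfun R I) : Qfun R I := fun i => emb r * f i.

Lemma qfun_addA : associative qfun_add.
Proof. by move=> f g k; apply: funext => i; exact: addrA. Qed.
Lemma qfun_addC : commutative qfun_add.
Proof. by move=> f g; apply: funext => i; exact: addrC. Qed.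
Lemma qfun_add0 : left_id qfun_zero qfun_add.
Proof. by move=> f; apply: funext => i; exact: add0r. Qed.
Lemma qfun_addN : left_inverse qfun_zero qfun_opp qfun_add.
Proof. by move=> f; apply: funext => i; exact: addNr. Qed.

HB.instance Definition _ :=
  GRing.isZmodule.Build (Qfun R I) qfun_addA qfun_addC qfun_add0 qfun_addN.

Lemma qfun_scaleA a b f : qfun_scale a (qfun_scale b f) = qfun_scale (a * b) f.
Proof. by apply: funext => i; rewrite /qfun_scale mulrA -tofracM. Qed.
Lemma qfun_scale1 : left_id 1 qfun_scale.
Proof. by move=> f; apply: funext => i; rewrite /qfun_scale /emb tofrac1 mul1r. Qed.
Lemma qfun_scaleDr : right_distributive qfun_scale +%R.
Proof. by move=> a f g; apply: funext => i; exact: mulrDr. Qed.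
Lemma qfun_scaleDl f : {morph qfun_scale^~ f : a b / a + b}.
Proof.
by move=> a b; apply: funext => i; rewrite /qfun_scale /emb tofracD mulrDl.
Qed.

HB.instance Definition _ := GRing.Zmodule_isLmodule.Build R (Qfun R I)
  qfun_scaleA qfun_scale1 qfun_scaleDr qfun_scaleDl.

Lemma qfunD (f g : Qfun R I) i : (f + g) i = f i + g i. Proof. by []. Qed.
Lemma qfunZ r (f : Qfun R I) i : (r *: f) i = emb r * f i. Proof. by []. Qed.

End QfunLmod.

(** * The quotient field of a valuation domain *)

Lemma emb0 (R : idomainType) : emb (0 : R) = 0.
Proof. exact: tofrac0. Qed.

Lemma emb1 (R : idomainType) : emb (1 : R) = 1.
Proof. exact: tofrac1. Qed.

Lemma embN (R : idomainType) (a : R) : emb (- a) = - emb a.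
Proof. exact: tofracN. Qed.

Lemma embD (R : idomainType) (a b : R) : emb (a + b) = emb a + emb b.
Proof. exact: tofracD. Qed.

Lemma embB (R : idomainType) (a b : R) : emb (a - b) = emb a - emb b.
Proof. exact: tofracB. Qed.

Lemma embM (R : idomainType) (a b : R) : emb (a * b) = emb a * emb b.
Proof. exact: tofracM. Qed.

Lemma emb_eq0 (R : idomainType) (a : R) : (emb a == 0) = (a == 0).
Proof. exact: tofrac_eq0. Qed.

Lemma emb_inj (R : idomainType) : injective (@emb R).
Proof. by move=> a b /eqP; rewrite /emb tofrac_eq => /eqP. Qed.

Lemma emb_num_den (R : idomainType) (x : Qf R) :
  exists a b, b != 0 /\ x = emb a / emb b.
Proof.
elim/quotW: x => x; exists (frac x).1, (frac x).2.
have dx : (frac x).2 != 0 by exact: denom_ratioP.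
split=> //; apply: (canRL (mulfK _)); first by rewrite emb_eq0.
rewrite /emb /FracField.tofrac; unlock.
rewrite -[LHS]FracField.pi_mul; apply/eqmodP; rewrite /= FracField.equivfE.
by rewrite /FracField.mulf !numden_Ratio ?oner_eq0 ?mulr1 ?mul1r // mulrC.
Qed.

Lemma emb_valuation (R : idomainType) (x y : Qf R) : valuation_domain R ->
  (exists t, x = emb t * y) \/ (exists t, y = emb t * x).
Proof.
move=> [vd _]; have [a [b [b0 ->]]] := emb_num_den x.
have [c [d [d0 ->]]] := emb_num_den y.
have {}b0 : emb b != 0 by rewrite emb_eq0.
have {}d0 : emb d != 0 by rewrite emb_eq0.
have [[t tE]|[t tE]] := vd (a * d) (c * b); [right|left]; exists t.
  by apply/eqP; rewrite mulrA -embM eqr_div // -!embM -mulrA -tE.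
by apply/eqP; rewrite mulrA -embM eqr_div // -!embM -mulrA -tE.
Qed.

(** [R] is local: if [1 + a] divides [a] it divides 1, and if [a] divides [1 + a] then [a] divides
    1. *)
Lemma valuation_unit1D (R : idomainType) (a : R) : valuation_domain R ->
  a \isn't a GRing.unit -> 1 + a \is a GRing.unit.
Proof.
move=> [vd _] aU; have [[t tE]|[t tE]] := vd (1 + a) a.
  have ta : (1 - t) * (1 + a) = 1 by rewrite mulrBl mul1r -tE addrK.
  by apply/unitrP; exists (1 - t); split; rewrite // mulrC.
have ta : (t - 1) * a = 1 by rewrite mulrBl -tE mul1r addrK.
by case/negP: aU; apply/unitrP; exists (t - 1); split; rewrite // mulrC.
Qed.

Lemma uniserial_cyclic (R : idomainType) (U : lmodType R) :
  (forall u v : U, exists t : R, u = t *: v \/ v = t *: u) -> uniserial U.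
Proof.
move=> UV S T [S0 SD SZ] [T0 TD TZ].
have [ST|nST] := EM (forall x, S x -> T x); [by left | right => v Tv].
apply: contrapT => nSv; apply: nST => u Su.
by have [t [->|vE]] := UV u v; [exact: TZ | case: nSv; rewrite vE; exact: SZ].
Qed.

(** * The twisted module: uniseriality, type, non-standardness *)

Section TwistedModule.
Variables (I : Type) (lt : I -> I -> Prop).
Hypothesis ltI : omega1_order lt.
Variable R : idomainType.
Hypothesis vd : valuation_domain R.
Variable r : I -> R.
Hypothesis r0 : forall i, r i != 0.
Hypothesis rle : forall i j, le lt i j -> rdvd (r i) (r j).
Variables J A : Qf R -> Prop.
Hypothesis JE : forall x, J x <-> exists i, invR (r i) x.
Hypothesis AS : Qsubmod A.
Hypothesis Ar : forall i, ~ A (emb (r i))^-1.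

(* [r i A], which [Ar] makes a proper ideal of [R]. *)
Definition level_ideal i (a : R) := A (emb a / emb (r i)).

Lemma er0 i : emb (r i) != 0. Proof. by rewrite emb_eq0. Qed.

Lemma A0 : A 0. Proof. by case: AS. Qed.
Lemma AD x y : A x -> A y -> A (x + y). Proof. by case: AS => _ h _; exact: h. Qed.
Lemma AZ a x : A x -> A (emb a * x). Proof. by case: AS => _ _; exact. Qed.
Lemma AN x : A x -> A (- x).
Proof. by move=> /(AZ (-1)); rewrite embN emb1 mulN1r. Qed.
Lemma AB x y : A x -> A y -> A (x - y). Proof. by move=> Ax /AN; exact: AD. Qed.
Lemma AZ_unit a x : a \is a GRing.unit -> A (emb a * x) -> A x.
Proof. by move=> aU /(AZ a^-1); rewrite mulrA -embM mulVr // emb1 mul1r. Qed.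

(** An element of [A] outside [r_i^-1 R] would have [r_i^-1] as a multiple, against [Ar]. *)
Lemma A_level i x : A x -> exists2 t, level_ideal i t & x = emb t / emb (r i).
Proof.
move=> Ax; have [[t xE]|[t rE]] := emb_valuation x (emb (r i))^-1 vd.
  by exists t => //; rewrite /level_ideal -xE.
by case: (@Ar i); rewrite rE; exact: AZ.
Qed.

Lemma level_ideal0 i : level_ideal i 0.
Proof. by rewrite /level_ideal emb0 mul0r; exact: A0. Qed.

Lemma level_idealD i a b :
  level_ideal i a -> level_ideal i b -> level_ideal i (a + b).
Proof. by rewrite /level_ideal embD mulrDl; exact: AD. Qed.

Lemma level_idealM i a b : level_ideal i b -> level_ideal i (a * b).
Proof. by rewrite /level_ideal embM -mulrA; exact: AZ. Qed.

Lemma level_idealS i j a : le lt i j -> level_ideal j a -> level_ideal i a.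
Proof.
move=> /rle [c cE] /(AZ c); rewrite /level_ideal.
have := er0 j; rewrite cE embM mulf_eq0 negb_or => /andP [c0 _].
by rewrite invfM mulrCA mulVKf.
Qed.

Lemma level_ideal_unit i u a : u \is a GRing.unit -> level_ideal i a ->
  u + a \is a GRing.unit.
Proof.
move=> uU Na; have -> : u + a = u * (1 + u^-1 * a).
  by rewrite mulrDr mulr1 mulrA divrr // mul1r.
rewrite unitrM uU /=; apply: (valuation_unit1D vd); apply/negP => vU.
apply: (@Ar i); apply: (AZ_unit vU); exact: level_idealM Na.
Qed.

Variable e : I -> I -> R.
Hypothesis e1 : forall i, e i i = 1.
Hypothesis eU : forall i j, le lt i j -> e j i \is a GRing.unit.
Hypothesis eM : forall i j k, le lt i j -> le lt j k ->
  cong level_ideal i (e k i) (e j i * e k j).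

Definition evt (P : I -> Prop) := exists i, forall j, le lt i j -> P j.

Lemma evt_and P Q : evt P -> evt Q -> evt (fun i => P i /\ Q i).
Proof.
move=> [i iP] [j jQ]; have [k [ik jk]] := ub2 ltI i j; exists k => l kl.
by split; [apply: iP | apply: jQ]; apply: le_trans ltI _ _ _ _ kl.
Qed.

Lemma evt_imp (P Q : I -> Prop) : (forall i, P i -> Q i) -> evt P -> evt Q.
Proof. by move=> PQ [i iP]; exists i => j /iP /PQ. Qed.

Lemma evt_ex P i : evt P -> exists2 j, le lt i j & P j.
Proof. by move=> [j jP]; have [k [ik /jP]] := ub2 ltI i j; exists k. Qed.

(* The twisted module is the direct limit of the modules [r_i^-1 R / A] along
   multiplication by the [e j i]; an element of it is a thread, i.e. the
   eventually defined family of its images. *)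
Definition coh (f : Qfun R I) i :=
  forall j, le lt i j -> A (emb (e j i) * f i - f j).

Definition thread (f : Qfun R I) := evt (fun i => invR (r i) (f i) /\ coh f i).

Definition null (f : Qfun R I) := evt (fun i => A (f i)).

(** The thread started by [x] at level [i]; only its values at levels [j] from [i] on matter. *)
Definition lift_thread i x : Qfun R I := fun j => emb (e j i) * x.

Lemma invRD a x y : invR a x -> invR a y -> invR (R := R) a (x + y).
Proof. by move=> [s ->] [t ->]; exists (s + t); rewrite embD mulrDl. Qed.

Lemma invRZ a b x : invR a x -> invR (R := R) a (emb b * x).
Proof. by move=> [s ->]; exists (b * s); rewrite embM mulrA. Qed.

Lemma invR_le i j x : le lt i j -> invR (r i) x -> invR (r j) x.
Proof.
move=> /rle [c cE] [s ->]; exists (s * c).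
have := er0 j; rewrite cE !embM mulf_eq0 negb_or => /andP [c0 _].
by rewrite invfM mulrA mulfK.
Qed.

Lemma A_scale_invR i a x : level_ideal i a -> invR (r i) x -> A (emb a * x).
Proof. by move=> Na [s ->]; rewrite mulrCA; exact: AZ. Qed.

Lemma submod_thread : submod thread.
Proof.
have [i0] := omega1_inhabited ltI.
split=> [|f g|a f].
- exists i0 => i _; split; first by exists 0; rewrite emb0 mul0r.
  by move=> j _; rewrite mulr0 subrr; exact: A0.
- move=> /evt_and h /h; apply: evt_imp => i [[fi fA] [gi gA]].
  split; first exact: invRD.
  move=> j ij; rewrite !qfunD mulrDr opprD addrACA.
  by apply: AD; [exact: fA | exact: gA].
- apply: evt_imp => i [fi fA]; split; first exact: invRZ.
  by move=> j ij; rewrite !qfunZ mulrCA -mulrBr; apply: AZ; exact: fA.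
Qed.

Lemma submod_null : submod null.
Proof.
have [i0] := omega1_inhabited ltI.
split=> [|f g|a f].
- by exists i0 => i _; exact: A0.
- by move=> /evt_and h /h; apply: evt_imp => i [fi gi]; exact: AD.
- by apply: evt_imp => i; exact: AZ.
Qed.

Lemma null_thread f : null f -> thread f.
Proof.
move=> [i fA]; exists i => j ij; split.
  by have [t _ ->] := A_level j (fA j ij); exists t.
move=> k jk; apply: AB; first exact/AZ/fA.
exact/fA/(le_trans ltI ij jk).
Qed.

Lemma coh_lift i j x : le lt i j -> invR (r i) x -> coh (lift_thread i x) j.
Proof.
move=> ij xi k jk; rewrite /lift_thread mulrA -embM -mulrBl -embB.
apply: A_scale_invR xi; rewrite mulrC; apply: cong_sym (eM ij jk).
exact: level_idealM.
Qed.

Lemma thread_lift i x : invR (r i) x -> thread (lift_thread i x).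
Proof.
move=> xi; exists i => j ij; split; first exact/(invR_le ij)/invRZ.
exact: coh_lift.
Qed.

Lemma invR_inv i : invR (r i) (emb (r i))^-1.
Proof. by exists 1; rewrite emb1 mul1r. Qed.

Section Presentation.
Variables (U : lmodType R) (p : Qfun R I -> U).
Hypothesis pD : forall f g, thread f -> thread g -> p (f + g) = p f + p g.
Hypothesis pZ : forall (a : R) f, thread f -> p (a *: f) = a *: p f.
Hypothesis pS : forall u, exists f, thread f /\ p f = u.
Hypothesis pK : forall f, thread f -> (p f = 0 <-> null f).

Lemma threadZ a f : thread f -> thread (a *: f).
Proof. by case: submod_thread => _ _; apply. Qed.

(** Coherence at [i] determines all later values modulo [A] from those at [i], so one level
    decides. *)
Lemma p_multiple f g t i : thread f -> thread g -> coh f i -> coh g i ->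
  f i = emb t * g i -> p f = t *: p g.
Proof.
move=> fT gT fi gi fg; apply/eqP; rewrite -subr_eq0; apply/eqP.
have tg := threadZ t gT; have ntg := threadZ (-1) tg.
rewrite -pZ // -scaleN1r -pZ // -pD //; apply/pK.
  by case: submod_thread => _ + _; apply.
exists i => j ij; rewrite qfunD !qfunZ embN emb1 mulN1r.
have := AB (AZ t (gi j ij)) (fi j ij).
by rewrite mulrBr mulrCA -fg opprB addrC addrA subrK.
Qed.

Lemma uniserial_twisted : uniserial U.
Proof.
apply: uniserial_cyclic => u v.
have [f [fT <-]] := pS u; have [g [gT <-]] := pS v.
have [i0] := omega1_inhabited ltI.
have [i _ [[_ fi] [_ gi]]] := evt_ex i0 (evt_and fT gT).
have [[t fg]|[t gf]] := emb_valuation (f i) (g i) vd; exists t; [left|right].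
  exact: p_multiple fT gT fi gi fg.
exact: p_multiple gT fT gi fi gf.
Qed.

(** The image in the limit of the generator [r_i^-1] of level [i]. *)
Definition gen i := p (lift_thread i (emb (r i))^-1).

Lemma thread_gen i : thread (lift_thread i (emb (r i))^-1).
Proof. exact/thread_lift/invR_inv. Qed.

(** Since the [e j i] are units, nothing new dies on passing to higher levels. *)
Lemma genZ_eq0 i t : t *: gen i = 0 <-> level_ideal i t.
Proof.
have gT := thread_gen i; rewrite /gen -pZ //; rewrite pK; last exact: threadZ.
split=> [/(evt_ex i) [j ij]|Nt].
  by rewrite qfunZ mulrCA; apply: AZ_unit; exact: eU.
by exists i => j ij; rewrite qfunZ mulrCA; exact: AZ.
Qed.

Lemma gen_neq0 i : gen i <> 0.
Proof.
rewrite -[gen i]scale1r genZ_eq0 /level_ideal emb1 mul1r; exact: Ar.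
Qed.

Lemma gen_step i j c : le lt i j -> r j = c * r i ->
  gen i = (e j i * c) *: gen j.
Proof.
move=> ij cE; apply: (p_multiple (thread_gen i) (thread_gen j)).
- exact: coh_lift ij (invR_inv i).
- exact: coh_lift (le_refl _ j) (invR_inv j).
have := er0 j; rewrite /lift_thread e1 emb1 mul1r cE !embM mulf_eq0 negb_or.
by case/andP => c0 _; rewrite invfM mulrA mulfK.
Qed.

Lemma J_invR i x : J x -> exists2 j, le lt i j & invR (r j) x.
Proof.
move=> /JE [k xk]; have [j [ij kj]] := ub2 ltI i k.
by exists j => //; exact: invR_le xk.
Qed.

(** For any [i], multiplication by [r i] carries [J] to [Dv (gen i)] and [A] to [Ann (gen i)], which
    is [r_i A]. *)
Lemma twisted_type : has_type U J A.
Proof.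
have [i] := omega1_inhabited ltI.
have ri0 := er0 i.
have Ann0 : Ann (gen i) 0 by exists 0; rewrite emb0 scale0r.
exists (gen i); split; first exact/eqP/gen_neq0.
exists (fun x => x * emb (r i)); split.
- move=> x /(J_invR i) [j ij xj].
  (* If [x * emb (r i)] is in [R], the divisor 1 serves. Otherwise its inverse [q] is in [R], and
     [gen i] is [q] times the thread of [e j i * x] from a level [j] with [x] in [r_j^-1 R]. *)
  have [[t tE]|[q qE]] := emb_valuation (x * emb (r i)) 1 vd.
    exists 1; split; first by exists (gen i); rewrite scale1r.
    by exists t; rewrite tE mulr1 emb1 divr1.
  have q0 : emb q != 0.
    by apply/eqP => q0; move/eqP: qE; rewrite q0 mul0r oner_eq0.
  have qx : emb q * x = (emb (r i))^-1.
    by apply: (mulIf ri0); rewrite -mulrA -qE mulVf.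
  exists q; split; last first.
    by exists 1; rewrite emb1 mul1r; apply: (mulfI q0); rewrite -qE mulfV.
  have xe : invR (r j) (emb (e j i) * x) by exact: invRZ.
  exists (p (lift_thread j (emb (e j i) * x))); apply/esym.
  apply: (p_multiple (thread_gen i) (thread_lift xe)).
  + exact: coh_lift ij (invR_inv i).
  + exact: coh_lift (le_refl _ j) xe.
  by rewrite /lift_thread e1 emb1 mul1r mulrCA qx.
- by move=> x y _ _; rewrite mulrDl subrr.
- by move=> a x _; rewrite mulrA subrr.
(* At a high level [j], [q * f j] equals [(e j i + t) / r i] with [t] in [r_i A]; as [e j i + t] is
   a unit, [1 / (q * r i)] is a multiple of [f j] and lies in [r_j^-1 R]. *)
- move=> d [q [[b qb] [s dE]]]; have [f [fT fb]] := pS b.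
  have q0 : emb q != 0.
    rewrite emb_eq0; apply/eqP => q0; apply: (@gen_neq0 i).
    by rewrite -qb q0 scale0r.
  exists (d / emb (r i)); split; last by rewrite divfK // subrr.
  have gT := thread_gen i.
  pose g := q *: f + (-1) *: lift_thread i (emb (r i))^-1.
  have dT : thread g.
    by case: submod_thread => _ + _; apply; exact: threadZ.
  have /(proj1 (pK dT)) gN : p g = 0.
    by rewrite pD ?pZ //; [rewrite fb qb scaleN1r subrr | exact: threadZ..].
  have [j ij [gA [fj _]]] := evt_ex i (evt_and gN fT).
  have [t Nt] := A_level i gA.
  rewrite /g qfunD !qfunZ embN emb1 mulN1r => /eqP; rewrite subr_eq.
  rewrite -mulrDl -embD addrC => /eqP qf.
  have uU := level_ideal_unit (eU ij) Nt.
  rewrite dE; apply/JE; exists j.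
  suff -> : emb s / emb q / emb (r i) = emb (s * (e j i + t)^-1) * f j.
    exact: invRZ.
  apply: (mulfI q0); rewrite [RHS]mulrCA qf [RHS]mulrA -embM.
  by rewrite -(mulrA s) mulVr // mulr1 mulrA [emb q * _]mulrC divfK.
- move=> x Jx; split=> [[t [tE]]|Ax].
    by move=> /genZ_eq0; rewrite /level_ideal -tE mulfK.
  have [t Nt ->] := A_level i Ax; exists t; split; first by rewrite divfK.
  exact/genZ_eq0.
Qed.

Hypothesis eC : forall c, (forall i, c i \is a GRing.unit) ->
  ~ forall i j, lt i j -> cong level_ideal i (e j i * c j) (c i).

(* A presentation of [U] by submodules [A'] and [J'] yields elements [y i] of
   [J'] lying over the [gen i]; the quotients [y i * r i / (y j * r j)] agree
   with [e j i] modulo [level_ideal i], and so trivialise the twist. *)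
Lemma twisted_not_standard : ~ standard U.
Proof.
move=> [J' [A' [f [[J0 JD JZ] [A'0 _ A'Z] AJ' [fD fZ fS fK]]]]].
have /choice [y yP] i : exists y, J' y /\ f y = gen i by exact: fS.
have yJ i : J' (y i) by case: (yP i).
have fy i : f (y i) = gen i by case: (yP i).
have y0 i : y i != 0.
  apply/eqP => yi; apply: (@gen_neq0 i); rewrite -fy yi.
  by apply/fK.
pose z i := y i * emb (r i).
have z0 i : z i != 0 by rewrite mulf_neq0 // er0.
(* [w] is some [t *: y j], else [y j] would be in [A'] and [gen j] zero; then [t] kills [gen j], and
   [w / z j] is [t / r j]. *)
have A'A w j : A' w -> A (w / z j).
  move=> A'w; have [[t wE]|[t yE]] := emb_valuation w (y j) vd; last first.
    case: (@gen_neq0 j); rewrite -fy; apply/fK => //.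
    by rewrite yE; exact: A'Z.
  have : f w = 0 by apply/fK => //; exact: AJ'.
  rewrite wE fZ // fy => /genZ_eq0.
  by rewrite /level_ideal /z -mulf_div mulrA divfK.
have zE i j : le lt i j -> exists2 t, level_ideal i t &
    z i = emb (e j i + t) * z j.
  move=> ij; have [c cE] := rle ij.
  have c0 : emb c != 0.
    by have := er0 j; rewrite cE embM mulf_eq0 negb_or => /andP [].
  (* By [gen_step], [y i + a y j] lies over 0, hence in [A']. *)
  pose a := - (e j i * c).
  have /(A'A _ j) : A' (y i + emb a * y j).
    apply/fK; first by apply: JD => //; exact: JZ.
    rewrite fD //; last exact: JZ.
    by rewrite fZ // !fy scaleNr -gen_step // subrr.
  move=> /(A_level i) [t Nt tE]; exists t => //.
  have yE : y i + emb a * y j = emb t / emb (r i) * z j by rewrite -tE divfK.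
  have -> : z i = (y i + emb a * y j) * emb (r i) - emb a * y j * emb (r i).
    by rewrite -mulrBl addrK.
  rewrite yE mulrAC divfK ?er0 // embD mulrDl addrC; congr (_ + _).
  rewrite /a embN !mulNr opprK /z cE !embM -!mulrA; congr (_ * _).
  by rewrite mulrCA.
have [i0] := omega1_inhabited ltI.
(* All [z i] are compared with one reference [z i0]; above [i0] the unit from [zE] is inverted. *)
have /choice [c cP] i : exists c, c \is a GRing.unit /\ z i = emb c * z i0.
  have [ii0|i0i] := le_total ltI i i0.
    have [t Nt ->] := zE _ _ ii0; exists (e i0 i + t); split=> //.
    exact: level_ideal_unit (eU ii0) Nt.
  have [t Nt ->] := zE _ _ i0i; have uU := level_ideal_unit (eU i0i) Nt.
  exists (e i i0 + t)^-1; rewrite unitrV; split=> //.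
  by rewrite mulrA -embM mulVr // emb1 mul1r.
apply: (eC (c := c)) => [i|i j ij]; first by case: (cP i).
have [t Nt] := zE i j (or_introl ij).
have [_ ->] := cP i; have [_ ->] := cP j.
rewrite mulrA -embM => /(mulIf (z0 i0))/(@emb_inj R) ->.
rewrite /cong mulrDl opprD addrA subrr add0r mulrC -mulNr.
exact: level_idealM.
Qed.

End Presentation.
End TwistedModule.

(** * Assembly of the theorem *)

Lemma countable_level (I : Type) (R : idomainType) (r : I -> R)
    (A : Qf R -> Prop) (i j : I) :
  valuation_domain R -> Qsubmod A -> (forall i, r i != 0) ->
  (forall i, ~ A (emb (r i))^-1) ->
  countable_mod (level_ideal r A i) (level_ideal r A j) ->
  countable_quot (scaleQ (r i) A) (scaleQ (r j) A).
Proof.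
move=> vd AS r0 Ar [f fP].
have /choice [q qP] (x : Qf R) : exists a, (exists b, x = emb b) -> x = emb a.
  have [[b ->]|nb] := EM (exists b, x = emb b); first by exists b.
  by exists 0.
have qA x : scaleQ (r i) A x -> x = emb (q x) /\ level_ideal r A i (q x).
  move=> [y [Ay xE]]; have [t Nt yE] := A_level vd AS Ar i Ay.
  have xt : x = emb t by rewrite xE yE mulrC divfK //; exact: er0.
  have qx := qP _ (ex_intro _ t xt); split=> //.
  by move: Nt; rewrite /level_ideal -xt -qx.
exists (f \o q) => x y /qA [xE Nx] /qA [yE Ny] fxy.
exists (emb (q x - q y) / emb (r j)); split; first exact: fP.
by rewrite mulrC divfK; [rewrite embB -xE -yE | exact: er0].
Qed.

Theorem theorem8 :
  not_CH ->
  forall (R : idomainType), valuation_domain R -> card_aleph1 R ->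
  forall (I : Type) (lt : I -> I -> Prop), omega1_order lt ->
  forall (r : I -> R),
    (forall nu, r nu != 0) ->
    (forall mu nu, lt mu nu -> rdvd (r mu) (r nu)) ->
  forall (J A : Qf R -> Prop),
    (forall x, J x <-> exists nu, invR (r nu) x) ->
    Qsubmod A -> Qsubset A J -> ~ Qsubset J A ->
    (forall nu, exists mu, lt nu mu /\
        ~ countable_quot (scaleQ (r nu) A) (scaleQ (r mu) A)) ->
  exists U : lmodType R, uniserial U /\ ~ standard U /\ has_type U J A.
Proof.
move=> nCH R vd R1 I lt ltI r r0 rlt J A JE AS _ nJA unc.
have rle i j : le lt i j -> rdvd (r i) (r j).
  by case=> [/rlt //|->]; exists 1; rewrite mul1r.
(* [A] is not all of [J], so it misses part of some [r_n0^-1 R]. *)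
have [n0 [s nAs]] : exists n0 s, ~ A (emb s / emb (r n0)).
  apply: contrapT => nA; apply: nJA => x /JE [n [s xE]].
  by apply: contrapT => nAx; apply: nA; exists n, s; rewrite -xE.
(* Replacing the first [n0] terms of [r] makes all [r i A] proper ideals. *)
have /choice [m mP] i : exists k, le lt n0 k /\
    ((lt i n0 /\ k = n0) \/ (le lt n0 i /\ k = i)).
  have [?|?] := lt_or_le ltI i n0; last by exists i; split=> //; right.
  by exists n0; split; [exact: le_refl | left].
have m_le i j : le lt i j -> le lt (m i) (m j).
  have [_ [[i0 ->]|[i0 ->]]] := mP i; first by case: (mP j).
  have [_ [[j0 _]|[_ -> //]]] := mP j => ij.
  by case: (lt_irr ltI (le_lt_trans ltI i0 (le_lt_trans ltI ij j0))).
have mE i : le lt n0 i -> m i = i.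
  have [_ [[i0 _]|[_ -> //]]] := mP i => n0i.
  by case: (lt_irr ltI (le_lt_trans ltI n0i i0)).
pose r' i := r (m i).
have r'0 i : r' i != 0 by exact: r0.
have r'le i j : le lt i j -> rdvd (r' i) (r' j) by move=> /m_le /rle.
have J'E x : J x <-> exists i, invR (r' i) x.
  rewrite JE; split=> [[k xk]|[i xi]]; last by exists (m i).
  have [j [kj n0j]] := ub2 ltI k n0; exists j; rewrite /r' mE //.
  exact: (invR_le r0 rle kj xk).
have Ar i : ~ A (emb (r' i))^-1.
  have [c cE] := rle _ _ (proj1 (mP i)) => Ai; apply: nAs.
  have := r'0 i; rewrite /r' cE mulf_eq0 negb_or => /andP [c0 _].
  have := AZ AS (s * c) Ai.
  by rewrite /r' cE !embM invfM mulrA mulfK // emb_eq0.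
have [h h_inj] := card_aleph1_embed ltI R1.
have diag (F : R -> nat -> bool) : exists b, forall c, F c <> b.
  apply: contrapT => nF; apply: (nCH R R1); exists F => g.
  by apply: contrapT => ng; apply: nF; exists g => c Fc; apply: ng; exists c.
(* Pass to [k] above [i] and [n0], where [r'] agrees with [r]; countability at [i] would restrict to
   the smaller ideal at [k]. *)
have unc' i : exists j, lt i j /\
    ~ countable_mod (level_ideal r' A i) (level_ideal r' A j).
  have [k [ik n0k]] := ub2 ltI i n0; have [j [kj ncq]] := unc k; exists j.
  split=> [|[f fP]]; first exact: le_lt_trans ltI _ _ _ ik kj.
  have n0j : le lt n0 j by apply: le_trans ltI _ _ _ n0k _; left.
  apply: ncq; rewrite -(mE k n0k) -(mE j n0j).
  apply: (countable_level vd AS r'0 Ar); exists f => x y Nx Ny.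
  by apply: fP; exact: (level_idealS r'0 r'le AS ik).
have [e [e1 eU eM eC]] := nontrivial_twist ltI (level_ideal0 r' AS)
  (level_idealD AS) (level_idealM AS) (level_idealS r'0 r'le AS)
  (fun i a => level_ideal_unit vd AS Ar (unitr1 R)) unc' h_inj diag.
have [U [p [pD pZ pS pK]]] := subquotient_lmod (submod_thread ltI r' AS e)
  (submod_null ltI AS) (null_thread ltI vd AS Ar e).
exists U; split; first exact: (uniserial_twisted ltI vd AS pD pZ pS pK).
split; last exact: (twisted_type ltI vd r'0 r'le J'E AS Ar e1 eU eM pD pZ pS pK).
exact: (twisted_not_standard ltI vd r'0 r'le AS Ar e1 eU eM pD pZ pK eC).
Qed.
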